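(* Let $n\ge 1$ and $x\in\mathbb{Y}_n$. Then the projective element $\mathscr{P}(x)\in\mathrm{Dend}(n)$ is a noncrossing tree containing the border side $1$; that is, there is a noncrossing tree $P$ in $O_n$ containing the side $1$ of $O_n$ such that $\Phi(P)=\mathscr{P}(x)$.
   Context: **Trees.** A planar binary tree is either a dot $\circ$ or a pair $(x\,y)$ of planar binary trees. Its degree is its number of vertices, i.e. number of leaves (dots) minus one. $\mathbb{Y}_n$ is the set of planar binary trees of degree $n\ge1$. Let $Y=(\circ\,\circ)\in\mathbb{Y}_1$. The over product $x/y$ identifies the root of $x$ with the leftmost leaf of $y$ (replace the leftmost $\circ$ of $y$ by $x$); the under product $x\backslash y$ identifies the root of $y$ with the rightmost leaf of $x$. They are associative and $(x/y)\backslash z=x/(y\backslash z)$. **Tamari order.** On $\mathbb{Y}_n$, $x\le y$ if $x$ is obtained from $y$ by a sequence of local changes replacing a subtree $(a(bc))$ by $((ab)c)$, where $a,b,c$ are planar binary trees, possibly dots. It is a lattice with minimum $\hat 0$ (left comb). **Dend.** $\mathrm{Dend}(n)=\mathbb{Z}\mathbb{Y}_n$ is the free abelian group on $\mathbb{Y}_n$; $/$ and $\backslash$ are extended bilinearly. The associative product $*:\mathrm{Dend}(m)\otimes\mathrm{Dend}(n)\to\mathrm{Dend}(m+n)$ is $x*y=\sum_{x/y\le z\le x\backslash y}z$ for trees $x,y$. **Projective elements.** For $x\in\mathbb{Y}_n$, $\mathscr{P}(x)=\sum_{\hat 0\le y\le x}y\in \mathrm{Dend}(n)$. These are the projective elements.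 **Noncrossing trees.** $O_n$ is a convex polygon with $n+1$ vertices $v_0,v_1,\dots,v_n$ in clockwise order, with base side $v_0v_n$ drawn at the bottom ($v_0$ on the left), and side $i$ equal to $v_{i-1}v_i$ for $1\le i\le n$ (for $n=1$ the single side is both the base side and side $1$). A noncrossing tree in $O_n$ (of degree $n$) is a maximal set of edges between vertices of $O_n$ with no two edges crossing (they may meet at endpoints) and with no cycle. It is based if it contains the base side. Noncrossing trees are identified with elements of $\mathrm{Dend}(n)$ by the injective map $\Phi$ which is the restriction of the morphism from the operad of noncrossing plants to the operad $\mathrm{Dend}$ sending, in $O_2$, $\{\text{base},\text{side }1\}\mapsto ((\circ\circ)\circ)$, $\{\text{side }1,\text{side }2\}\mapsto((\circ\circ)\circ)+(\circ(\circ\circ))$, $\{\text{base},\text{side }2\}\mapsto(\circ(\circ\circ))$. Explicitly: the unique noncrossing tree of $O_1$ is sent to $Y$. If $P$ is based of degree $n\ge2$, removing the base edge leaves a noncrossing tree $Q$ on $v_0,\dots,v_j$ and a noncrossing tree $R$ on $v_{j+1},\dots,v_n$ for some $0\le j\le n-1$, and $\Phi(P)=\Phi(Q)/Y\backslash\Phi(R)$, omitting ''$\Phi(Q)/$'' if $j=0$ and ''$\backslash\Phi(R)$'' if $j=n-1$. If $P$ is not based, let $v_0=v_{i_0},v_{i_1},\dots,v_{i_k}=v_n$ be the unique path in $P$ from $v_0$ to $v_n$ (then $i_0<i_1<\dots<i_k$), let $R_r$ be the restriction of $P$ to the vertices $v_{i_{r-1}},\dots,v_{i_r}$ (a based noncrossing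 tree with base side $v_{i_{r-1}}v_{i_r}$); then $\Phi(P)=\Phi(R_1)*\cdots*\Phi(R_k)$. *)

(* Defs.v *)
From HB Require Import structures.
From mathcomp Require Import all_boot all_order all_algebra.
From mathcomp.multinomials Require Export freeg.

Set Implicit Arguments.
Unset Strict Implicit.
Unset Printing Implicit Defensive.


Inductive tree : Type := Leaf | Node of tree & tree.

Fixpoint tree_encode (t : tree) : GenTree.tree unit :=
  if t is Node l r then GenTree.Node 1 [:: tree_encode l; tree_encode r]
  else GenTree.Node 0 [::].

Fixpoint tree_decode (t : GenTree.tree unit) : option tree :=
  match t with
  | GenTree.Node 0 [::] => Some Leaf
  | GenTree.Node 1 [:: l; r] =>
      if (tree_decode l, tree_decode r) is (Some l', Some r')
      then Some (Node l' r') else None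
  | _ => None
  end.

Lemma tree_encodeK : pcancel tree_encode tree_decode.
Proof. by elim=> [|l IHl r IHr] //=; rewrite IHl IHr. Qed.

HB.instance Definition _ := Countable.copy tree (pcan_type tree_encodeK).

Fixpoint degree (t : tree) : nat :=
  if t is Node l r then (degree l + degree r).+1 else 0.

Record Y (n : nat) : Type := YTree {ytree :> tree; _ : degree ytree == n}.

HB.instance Definition _ n := [isSub for @ytree n].
HB.instance Definition _ n := [Countable of Y n by <:].

(* The trees of height at most k; they serve to show that Y n is finite. *)
Fixpoint trees_height (k : nat) : seq tree :=
  if k is k'.+1 then
    Leaf :: [seq Node l r | l <- trees_height k', r <- trees_height k']
  else [:: Leaf].

Lemma trees_height_uniq k : uniq (trees_height k).
Proof.
elim: k => //= k IHk; apply/andP; split.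
  by apply/negP => /allpairsP[[l r] []].
by apply: allpairs_uniq => // -[l r] [l' r'] _ _ /= [-> ->].
Qed.

Lemma mem_trees_height t k : (degree t <= k)%N -> t \in trees_height k.
Proof.
elim: t k => [|l IHl r IHr] [|k] //=; rewrite ltnS => le_lr_k.
rewrite in_cons; apply/orP; right; apply: allpairs_f.
  by apply: IHl; apply: leq_trans le_lr_k; apply: leq_addr.
by apply: IHr; apply: leq_trans le_lr_k; apply: leq_addl.
Qed.

Lemma Y_enumP n : Finite.axiom (pmap (insub : tree -> option (Y n)) (trees_height n)).
Proof.
apply: Finite.uniq_enumP; first by rewrite pmap_sub_uniq ?trees_height_uniq.
move=> t; rewrite mem_pmap_sub mem_trees_height //.
by rewrite (eqP (valP t)).
Qed.

HB.instance Definition _ n := isFinite.Build (Y n) (@Y_enumP n).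

Definition Y1 : tree := Node Leaf Leaf.

(* [over x y] is x / y and [under x y] is x \ y. *)
Fixpoint over (x y : tree) : tree :=
  if y is Node l r then Node (over x l) r else x.

Fixpoint under (x y : tree) : tree :=
  if x is Node l r then Node l (under r y) else y.

Lemma degree_over x y : degree (over x y) == (degree x + degree y)%N.
Proof.
by elim: y => [|l /eqP IHl r _] /=; rewrite ?addn0 // IHl addnS addnA.
Qed.

Lemma degree_under x y : degree (under x y) == (degree x + degree y)%N.
Proof. by elim: x => [|l _ r /eqP IHr] //=; rewrite IHr addSn addnA. Qed.

Definition Yover (x y : tree) : Y (degree x + degree y) :=
  YTree (degree_over x y).
Definition Yunder (x y : tree) : Y (degree x + degree y) :=
  YTree (degree_under x y).

(* All the trees obtained from t by replacing one subtree (a(bc)) by ((ab)c). *)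
Fixpoint lower_rotations (t : tree) : seq tree :=
  if t is Node l r then
    (if r is Node b c then [:: Node (Node l b) c] else [::])
      ++ [seq Node l' r | l' <- lower_rotations l]
      ++ [seq Node l r' | r' <- lower_rotations r]
  else [::].

Definition tamari (n : nat) (x y : Y n) : bool :=
  connect (fun s t : Y n => ytree t \in lower_rotations s) y x.

Definition left_comb (n : nat) : tree := iter n (Node^~ Leaf) Leaf.

Lemma degree_left_comb n : degree (left_comb n) == n.
Proof. by elim: n => //= n /eqP ->; rewrite addn0. Qed.

Definition Y0hat (n : nat) : Y n := YTree (degree_left_comb n).

(* The free abelian group on all planar binary trees, i.e. the direct sum of *)
(* the groups Dend(n) = Z Y_n for n >= 0. The dot, which spans Dend(0), is a *)
(* unit for dover, dunder and dstar.                                         *)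
Definition Dend := {freeg tree / int}.

Local Open Scope ring_scope.

Definition bilinear_ext (f : tree -> tree -> Dend) (u v : Dend) : Dend :=
  fglift (fun x => fglift (f x) v) u.

Definition dover : Dend -> Dend -> Dend :=
  bilinear_ext (fun x y => << over x y >>).

Definition dunder : Dend -> Dend -> Dend :=
  bilinear_ext (fun x y => << under x y >>).

Definition dstar : Dend -> Dend -> Dend :=
  bilinear_ext (fun x y =>
    \sum_(z : Y (degree x + degree y)%N |
            tamari (Yover x y) z && tamari z (Yunder x y)) << ytree z >>).

Definition projective (n : nat) (x : Y n) : Dend :=
  \sum_(y : Y n | tamari (Y0hat n) y && tamari y x) << ytree y >>.

(* The vertices v_0, ..., v_n are the ordinals 0, ..., n, and the edge       *)
(* {v_i, v_j} with i < j is the pair (i, j).                               *)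
Definition edges (n : nat) := {set 'I_n.+1 * 'I_n.+1}.

Definition wf_edges (n : nat) (P : edges n) : Prop :=
  forall e, e \in P -> (e.1 < e.2)%N.

Definition noncrossing (n : nat) (P : edges n) : Prop :=
  forall e f, e \in P -> f \in P -> ~~ [&& e.1 < f.1, f.1 < e.2 & e.2 < f.2]%N.

Definition adj (n : nat) (P : edges n) : rel 'I_n.+1 :=
  fun i j => ((i, j) \in P) || ((j, i) \in P).

(* Cycles of size 2 merely run along an edge and back. *)
Definition acyclic (n : nat) (P : edges n) : Prop :=
  forall c, ucycle (adj P) c -> (size c <= 2)%N.

Definition noncrossing_forest (n : nat) (P : edges n) : Prop :=
  [/\ wf_edges P, noncrossing P & acyclic P].

Definition noncrossing_tree (n : nat) (P : edges n) : Prop :=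
  noncrossing_forest P /\
  forall Q : edges n, noncrossing_forest Q -> P \subset Q -> Q = P.

Definition restrict (n : nat) (P : edges n) (a b : 'I_n.+1) : edges n :=
  [set e in P | (a <= e.1)%N && (e.2 <= b)%N].

(* The vertex v_j such that deleting the base side v_a v_b from the based    *)
(* tree P on v_a, ..., v_b leaves a tree on v_a, ..., v_j and a tree on      *)
(* v_(j+1), ..., v_b: the last vertex in the connected component of v_a.     *)
Definition split_vertex (n : nat) (P : edges n) (a b : 'I_n.+1) : 'I_n.+1 :=
  [arg max_(j > a | connect (adj (P :\ (a, b))) a j) (j : nat)].

(* The vertices, after v_a, of the simple path in P from v_a to v_b. *)
Definition tree_path (n : nat) (P : edges n) (a b : 'I_n.+1) : seq 'I_n.+1 :=
  if [pick p : n.-bseq 'I_n.+1 |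
        [&& path (adj P) a p, uniq (a :: p) & last a p == b]] is Some p
  then p else [::].

(* The image under Phi of the restriction of P to v_a, ..., v_b, provided    *)
(* b - a <= k. Single vertices are sent to the dot, which is neutral for     *)
(* dover and dunder, so the factors to be omitted need no case distinction.  *)
Fixpoint Phi_rec (n : nat) (k : nat) (P : edges n) (a b : 'I_n.+1) : Dend :=
  if k is k'.+1 then
    if a == b then << Leaf >>
    else if (a, b) \in P then
      let j := split_vertex (restrict P a b) a b in
      dunder (dover (Phi_rec k' P a j) << Y1 >>)
             (Phi_rec k' P (inord j.+1) b)
    else
      let p := tree_path (restrict P a b) a b in
      \big[dstar / << Leaf >>]_(e <- zip (a :: p) p) Phi_rec k' P e.1 e.2
  else << Leaf >>.

Definition Phi (n : nat) (P : edges n) : Dend := Phi_rec n P ord0 ord_max.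

(* Main.v *)
Require Import Defs.
From HB Require Import structures.
From mathcomp Require Import all_boot all_order all_algebra.
From mathcomp Require Import zify.

Set Implicit Arguments.
Unset Strict Implicit.
Unset Printing Implicit Defensive.

(** Cutting a tree z after its first m inner vertices gives a pair (x, y), and
    the trees with that pair form the interval from x/y to x\y. Cutting is
    monotone for the Tamari order, so the product of the lower sums P(x) and
    P(y) is P(x\y); moreover P(l/Y) = P(l)/Y. Every tree is an iterated under
    product of trees l/Y along its right spine, so P(x) is the image of the
    noncrossing tree T(x) obtained from T(l) and T(r), for x = (l r), by
    placing them side by side and joining the first vertex of T(l) to the
    first vertex of T(r). *)

Import GRing.Theory.

(** * The Tamari order as an inductive relation on bare trees *)

Inductive rotation : tree -> tree -> Prop :=
| rotation_root a b c : rotation (Node a (Node b c)) (Node (Node a b) c)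
| rotation_left l l' r of rotation l l' : rotation (Node l r) (Node l' r)
| rotation_right l r r' of rotation r r' : rotation (Node l r) (Node l r').

Lemma rotationP t s : reflect (rotation t s) (s \in lower_rotations t).
Proof.
apply: (iffP idP) => [|]; last first.
  elim=> {t s} [a b c|l l' r _ IH|l r r' _ IH] /=.
  - by rewrite inE eqxx.
  - by rewrite !mem_cat (map_f (Node^~ r) IH) !orbT.
  - by rewrite !mem_cat (map_f (Node l) IH) !orbT.
elim: t s => [|l IHl r IHr] s //=; rewrite !mem_cat => /or3P[|/mapP|/mapP].
- by case: r {IHr} => [|b c] //; rewrite inE => /eqP ->; constructor.
- by case=> l' /IHl ? ->; constructor.
- by case=> r' /IHr ? ->; constructor.
Qed.

Inductive tle : tree -> tree -> Prop :=
| tle_refl t : tle t t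
| tle_step s u t of rotation t u & tle s u : tle s t.

Lemma tle_trans t s u : tle s t -> tle t u -> tle s u.
Proof. by move=> st tu; elim: tu st => // {}t v {}u r _ IH /IH; apply: tle_step. Qed.

Lemma rotation_tle t s : rotation t s -> tle s t.
Proof. by move=> r; apply: tle_step r (tle_refl _). Qed.

Lemma tle_homo (f : tree -> tree) :
  (forall t s, rotation t s -> tle (f s) (f t)) ->
  forall s t, tle s t -> tle (f s) (f t).
Proof.
move=> f_rot s t; elim=> [u|{}s u {}t /f_rot r _ IH]; first exact: tle_refl.
exact: tle_trans r.
Qed.

Lemma tle_Node l l' r r' : tle l l' -> tle r r' -> tle (Node l r) (Node l' r').
Proof.
move=> ll' rr'; apply: (@tle_trans (Node l' r)).
  by apply: (@tle_homo (Node^~ r)) ll' => t s ?; apply/rotation_tle/rotation_left.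
by apply: (@tle_homo (Node l')) rr' => t s ?; apply/rotation_tle/rotation_right.
Qed.

Lemma rotation_degree t s : rotation t s -> degree s = degree t.
Proof. by elim=> {t s} [a b c|l l' r _ IH|l r r' _ IH] /=; lia. Qed.

Lemma tle_degree s t : tle s t -> degree s = degree t.
Proof. by elim=> // {}s u {}t /rotation_degree <-. Qed.

Lemma degreeY n (x : Y n) : degree x = n.
Proof. exact/eqP/(valP x). Qed.

Lemma tamariP n (x y : Y n) : reflect (tle x y) (tamari x y).
Proof.
apply: (iffP connectP) => [[p]|le_xy].
  elim: p y => [|z p IH] y /=; first by move=> _ ->; apply: tle_refl.
  by move=> /andP[/rotationP yz /IH{}IH] /IH; apply: tle_step.
apply/connectP; move: le_xy.
(* Naming the underlying trees lets the induction on [tle] run over bare trees, with [y]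
   generalized. *)
have [s def_s] : exists s, s = ytree x by exists x.
have [t def_t] : exists t, t = ytree y by exists y.
rewrite -def_s -def_t => le_st; elim: le_st y def_t def_s => {s t}.
  by move=> t y def_t def_s; rewrite (_ : y = x) //; apply: val_inj; rewrite /= -def_t.
move=> s u t tu _ IH y def_t def_s.
have deg_u : degree u == n by rewrite (rotation_degree tu) def_t degreeY.
apply: connect_trans (IH (YTree deg_u) _ _) => //.
by apply/connect1/rotationP; rewrite /= -def_t.
Qed.

Definition Ytree (t : tree) : Y (degree t) := YTree (eqxx (degree t)).

(** Boolean form of [tle] free of the degree index; the quantifier only serves to view [s] in
    [Y (degree t)]. *)
Definition tleb (s t : tree) : bool :=
  [exists x : Y (degree t), (ytree x == s) && tamari x (Ytree t)].

Lemma tlebP s t : reflect (tle s t) (tleb s t).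
Proof.
apply: (iffP existsP) => [[x /andP[/eqP <- /tamariP]]|st] //.
have deg_s : degree s == degree t by rewrite (tle_degree st).
by exists (YTree deg_s); rewrite eqxx; apply/tamariP.
Qed.

Lemma tamariE n (x y : Y n) : tamari x y = tleb x y.
Proof. exact/tamariP/tlebP. Qed.

(** The sum, over the inner vertices, of the degree of the right subtree. A root rotation from
    [(a(bc))] to [((ab)c)] lowers it by [degree c + 1], whence antisymmetry of the order. *)
Fixpoint weight (t : tree) : nat :=
  if t is Node l r then weight l + weight r + degree r else 0.

Lemma rotation_weight t s : rotation t s -> weight s < weight t.
Proof.
elim=> {t s} [a b c|l l' r _|l r r' rr'] /=; [lia|lia|].
by rewrite (rotation_degree rr'); lia.
Qed.

Lemma tle_weight s t : tle s t -> s = t \/ weight s < weight t.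
Proof.
by elim=> [u|{}s u {}t /rotation_weight ut _ [->|us]]; [left|right|right; lia].
Qed.

Lemma tle_anti s t : tle s t -> tle t s -> s = t.
Proof. by move=> /tle_weight[|lt_st] // /tle_weight[|lt_ts] //; lia. Qed.

Lemma left_comb_tle t : tle (left_comb (degree t)) t.
Proof.
have NodeC a k :
    tle (left_comb (a + k).+1) (Node (left_comb a) (left_comb k)).
  (* The right subtree is [Node (left_comb k) Leaf], so one root rotation leads back to the case [k]
     inside the left subtree. *)
  elim: k => [|k IHk]; first by rewrite addn0; apply: tle_refl.
  apply: tle_step (rotation_root _ _ _) _; rewrite addnS.
  exact: tle_Node IHk (tle_refl _).
elim: t => [|l IHl r IHr]; first exact: tle_refl.
exact: tle_trans (NodeC _ _) (tle_Node IHl IHr).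
Qed.

(** * Cutting trees, and the intervals from x/y to x\y *)

Lemma rotation_underl x x' y : rotation x x' -> rotation (under x y) (under x' y).
Proof. by elim=> {x x'} *; constructor. Qed.

Lemma rotation_underr x y y' : rotation y y' -> rotation (under x y) (under x y').
Proof. by move=> yy'; elim: x => //= l _ r IHr; constructor. Qed.

Lemma tle_under x x' y y' :
  tle x x' -> tle y y' -> tle (under x y) (under x' y').
Proof.
move=> xx' yy'; apply: (@tle_trans (under x' y)).
  by apply: (@tle_homo (under^~ y)) xx' => t s ?; apply/rotation_tle/rotation_underl.
by apply: (@tle_homo (under x')) yy' => t s ?; apply/rotation_tle/rotation_underr.
Qed.

(* The trees induced on the first m and on the remaining inner vertices of t, *)
(* taken in infix order.                                                      *)
Fixpoint cut (m : nat) (t : tree) : tree * tree :=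
  if t is Node l r then
    if m <= degree l then ((cut m l).1, Node (cut m l).2 r)
    else (Node l (cut (m - (degree l).+1) r).1, (cut (m - (degree l).+1) r).2)
  else (Leaf, Leaf).

Lemma degree_cut m t : m <= degree t ->
  degree (cut m t).1 = m /\ degree (cut m t).2 = degree t - m.
Proof.
elim: t m => [|l IHl r IHr] m /=; first by case: m.
case: (leqP m (degree l)) => [le_ml _|lt_lm le_m] /=.
  by have [e1 e2] := IHl m le_ml; rewrite e2; split; lia.
have [|e1 e2] := IHr (m - (degree l).+1); first lia.
by rewrite e1 e2; split; lia.
Qed.

(** A rotation involves two inner vertices. If the cut separates them, both pieces are unchanged;
    otherwise the rotation takes place inside one piece. *)
Lemma rotation_cut m t s : rotation t s ->
  tle (cut m s).1 (cut m t).1 /\ tle (cut m s).2 (cut m t).2.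
Proof.
move=> ts; elim: ts m => {t s} [a b c|l l' r ll' IH|l r r' rr' IH] m /=.
- case: (leqP m (degree a)) => [le_ma|lt_am].
    rewrite leqW ?(leq_trans le_ma) ?leq_addr //=.
    by split; [apply: tle_refl | apply/rotation_tle/rotation_root].
  case: (leqP m _) => le_m.
    have -> : m - (degree a).+1 <= degree b by lia.
    by split; apply: tle_refl.
  have -> : (m - (degree a).+1 <= degree b) = false by lia.
  rewrite /= (_ : m - (degree a).+1 - (degree b).+1 = m - (degree a + degree b).+2); last lia.
  by split; [apply/rotation_tle/rotation_root | apply: tle_refl].
- rewrite (rotation_degree ll'); case: leqP => _ /=; have [IH1 IH2] := IH m.
    by split=> //; apply: tle_Node IH2 (tle_refl _).
  by split; [apply/rotation_tle/rotation_left | apply: tle_refl].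
- case: leqP => _ /=.
    by split; [apply: tle_refl | apply/rotation_tle/rotation_right].
  have [IH1 IH2] := IH (m - (degree l).+1).
  by split=> //; apply: tle_Node (tle_refl _) IH1.
Qed.

Lemma tle_cut m s t : tle s t ->
  tle (cut m s).1 (cut m t).1 /\ tle (cut m s).2 (cut m t).2.
Proof.
by move=> st; split;
  [apply: (@tle_homo (fun t => (cut m t).1)) st
  |apply: (@tle_homo (fun t => (cut m t).2)) st] => u v /(rotation_cut m)[].
Qed.

Lemma cut0 t : cut 0 t = (Leaf, t).
Proof. by elim: t => //= l -> r _. Qed.

Lemma cut_degree t : cut (degree t) t = (t, Leaf).
Proof.
elim: t => //= l _ r IHr; rewrite ifF ?subSS ?addKn ?IHr //.
by apply/negbTE; rewrite -ltnNge ltnS leq_addr.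
Qed.

Lemma cut_over x y : cut (degree x) (Defs.over x y) = (x, y).
Proof.
elim: y => [|l IHl r _] /=; first exact: cut_degree.
by rewrite (eqP (degree_over _ _)) leq_addr IHl.
Qed.

Lemma cut_under x y : cut (degree x) (under x y) = (x, y).
Proof.
elim: x => [|l _ r IHr] /=; first exact: cut0.
by rewrite leqNgt ltnS leq_addr subSS addKn /= IHr.
Qed.

Lemma over_cut_tle m t : tle (Defs.over (cut m t).1 (cut m t).2) t.
Proof.
(* One root rotation for each vertex on the left spine of [s]; this handles a cut passing through
   the right subtree. *)
have overN l r s : tle (Defs.over (Node l r) s) (Node l (Defs.over r s)).
  elim: s => [|p IHp q _] /=; first exact: tle_refl.
  apply: tle_trans (tle_Node IHp (tle_refl _)) _.
  exact/rotation_tle/rotation_root.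
elim: t m => [|l IHl r IHr] m /=; first exact: tle_refl.
case: leqP => _ /=; first exact: tle_Node (tle_refl _).
exact: tle_trans (overN _ _ _) (tle_Node (tle_refl _) (IHr _)).
Qed.

Lemma tle_under_cut m t : tle t (under (cut m t).1 (cut m t).2).
Proof.
have underN x y r : tle (Node (under x y) r) (under x (Node y r)).
  elim: x => [|a _ b IHb] /=; first exact: tle_refl.
  apply: tle_trans (tle_Node (tle_refl _) IHb).
  exact/rotation_tle/rotation_root.
elim: t m => [|l IHl r IHr] m /=; first exact: tle_refl.
case: leqP => _ /=; last exact: tle_Node (tle_refl _) _.
exact: tle_trans (tle_Node (IHl _) (tle_refl _)) (underN _ _ _).
Qed.

(** Both x/y and x\y are cut into [(x, y)], so monotonicity and antisymmetry force the same cut on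
    every tree between them. Conversely, a tree lies between the two regluings of its pieces. *)
Lemma cutP x y z :
  tle (Defs.over x y) z /\ tle z (under x y) <->
  cut (degree x) z = (x, y).
Proof.
split=> [[lo hi]|def_xy].
  have := tle_cut (degree x) lo; have := tle_cut (degree x) hi.
  rewrite cut_over cut_under /= => -[z1 z2] [x1 x2].
  by rewrite [cut _ z]surjective_pairing (tle_anti z1) // (tle_anti z2).
by have := (over_cut_tle (degree x) z, tle_under_cut (degree x) z); rewrite def_xy => -[].
Qed.

(** * Products of projective elements *)

Section LowerSums.

Local Open Scope ring_scope.

HB.instance Definition _ (f : tree -> Dend) :=
  GRing.isZmodMorphism.Build Dend Dend (fglift f) (lift_is_additive f).

Lemma fgliftU (f : tree -> Dend) t : fglift f << t >> = f t.
Proof. exact: etrans (liftU _ _ _) (scale1r _). Qed.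

Lemma bilinear_extE (f : tree -> tree -> Dend) (I J : finType)
    (P : pred I) (Q : pred J) (u : I -> tree) (v : J -> tree) :
  bilinear_ext f (\sum_(i | P i) << u i >>) (\sum_(j | Q j) << v j >>) =
  \sum_(i | P i) \sum_(j | Q j) f (u i) (v j).
Proof.
rewrite /bilinear_ext raddf_sum; apply: eq_bigr => i _.
rewrite /= fgliftU raddf_sum; apply: eq_bigr => j _.
by rewrite /= fgliftU.
Qed.

(** Indexing by bare trees avoids transport between equal degrees when forming l/Y and x\y. *)
Definition lower_sum (t : tree) : Dend := projective (Ytree t).

Lemma projectiveE n (x : Y n) :
  projective x = \sum_(y : Y n | tleb y x) << ytree y >>.
Proof.
apply: eq_bigl => y; rewrite !tamariE; apply: andb_idl => _.
by apply/tlebP; rewrite /= -[n in left_comb n](degreeY y); apply: left_comb_tle.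
Qed.

Lemma lower_sumE n (x : Y n) : projective x = lower_sum x.
Proof.
case: x => t t_n; have deg_t := eqP t_n.
case: n / deg_t t_n => t_n; congr projective.
exact: val_inj.
Qed.

Lemma lower_sum_Leaf : lower_sum Leaf = << Leaf >>.
Proof.
rewrite /lower_sum projectiveE (big_pred1 (Ytree Leaf)) // => y.
have -> : y = Ytree Leaf.
  by apply: val_inj; case: y => -[].
by rewrite /= eqxx; apply/tlebP/tle_refl.
Qed.

Lemma rotation_NodeLeaf l s : rotation (Node l Leaf) s ->
  exists2 l', s = Node l' Leaf & rotation l l'.
Proof.
move def_t: (Node l Leaf) => t ts.
case: ts def_t => // [k l' r kl' [-> ->]|k r r' rr' [_ def_r]].
  by exists l'.
by rewrite -def_r in rr'; inversion rr'.
Qed.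

Lemma tle_NodeLeaf l s :
  tle s (Node l Leaf) <-> exists2 l', s = Node l' Leaf & tle l' l.
Proof.
split=> [|[l' -> le_l]]; last exact: tle_Node le_l (tle_refl _).
move def_t: (Node l Leaf) => t st; elim: st l def_t => {s t} [t|s u t tu _ IH] l def_t.
  by exists l => //; apply: tle_refl.
move: tu; rewrite -def_t => /rotation_NodeLeaf[l' def_u ll'].
by have [l'' -> le_l''] := IH l' (esym def_u); exists l'' => //; apply: tle_step le_l''.
Qed.

(** No rotation applies at the root of l/Y, whose right child is a leaf, so the trees below it are
    exactly the l'/Y with l' below l. *)
Lemma lower_sum_NodeLeaf l :
  lower_sum (Node l Leaf) = dover (lower_sum l) << Y1 >>.
Proof.
(* A one-term sum brings the second factor into the form required by [bilinear_extE]. *)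
have -> : << Y1 >> = \sum_(i < 1) << Y1 >> :> Dend by rewrite big_ord1.
rewrite /dover /lower_sum !projectiveE bilinear_extE.
under [RHS]eq_bigr => y _ do rewrite big_ord1 /=.
have deg_N (y : Y (degree l)) : degree (Node y Leaf) == degree (Node l Leaf).
  by rewrite /= degreeY.
pose N (y : Y (degree l)) := YTree (deg_N y).
have N_inj : injective N by move=> y z [] /val_inj.
rewrite -(big_imset (fun z : Y (degree (Node l Leaf)) => << ytree z >>)
  (h := N) (A := [pred y : Y (degree l) | tleb y l])) //=; last by move=> ? ? _ _ /N_inj.
apply: eq_bigl => z; apply/tlebP/imsetP.
  move=> /tle_NodeLeaf[l' def_z le_l'].
  have deg_l' : degree l' == degree l by rewrite (tle_degree le_l').
  exists (YTree deg_l'); first by rewrite inE; apply/tlebP.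
  exact: val_inj.
case=> y; rewrite inE => /tlebP le_y ->.
exact: tle_Node le_y (tle_refl _).
Qed.

Lemma degree_cutY m n (z : Y (m + n)) :
  (degree (cut m z).1 == m) && (degree (cut m z).2 == n).
Proof.
have [] := @degree_cut m z; first by rewrite degreeY leq_addr.
by move=> -> ->; rewrite degreeY addKn !eqxx.
Qed.

Definition cutY m n (z : Y (m + n)) : Y m * Y n :=
  (YTree (andP (degree_cutY z)).1, YTree (andP (degree_cutY z)).2).

(** Group the trees below x\y by their cut (x', y') at [degree x]. Monotonicity gives x' below x and
    y' below y, and by [cutP] each fibre is the interval summed in the product of x' and y'. *)
Lemma lower_sum_under x y :
  lower_sum (under x y) = dstar (lower_sum x) (lower_sum y).
Proof.
pose m := degree x; pose n := degree y.
have deg_xy : degree (under x y) == (m + n)%N := degree_under x y.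
rewrite -(lower_sumE (YTree deg_xy)) /dstar /lower_sum !projectiveE bilinear_extE.
rewrite pair_big (partition_big (@cutY m n)
   (fun p => tleb p.1 x && tleb p.2 y)) /=; last first.
  move=> z /tlebP/(tle_cut m); rewrite cut_under /= => -[/tlebP -> /tlebP ->] //.
apply: eq_bigr => -[x' y'] /= /andP[/tlebP le_x /tlebP le_y].
have def_m := degreeY x'; have def_n := degreeY y'.
have eq_mn : (m + n = degree x' + degree y')%N by rewrite def_m def_n.
(* The fibre lives in [Y (m + n)] but the product sums over [Y (degree x' + degree y')]; the two
   degrees are only propositionally equal. *)
have sumE k (e : (m + n)%N = k) (P : pred tree) :
    \sum_(z : Y (m + n) | P z) << ytree z >> = \sum_(z : Y k | P z) << ytree z >> :> Dend.
  by case: k / e.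
under [RHS]eq_bigl => z do rewrite !tamariE /=.
rewrite -(sumE _ eq_mn (fun z => tleb (Defs.over x' y') z && tleb z (under x' y'))).
apply: eq_bigl => z; have [interval_cut cut_interval] := cutP x' y' z.
rewrite def_m in interval_cut cut_interval.
apply/andP/andP => [[_ /eqP[def_x' def_y']]|[/tlebP lo /tlebP hi]].
  have [] // := cut_interval; last by move=> /tlebP lo /tlebP.
  (* The remaining goal is the cut equation, read off from membership in the fibre. *)
  by rewrite -def_x' -def_y' -surjective_pairing.
have def_xy := interval_cut (conj lo hi).
split; first by apply/tlebP; apply: tle_trans hi (tle_under le_x le_y).
by apply/eqP; rewrite /cutY; congr (_, _); apply: val_inj; rewrite /= def_xy.
Qed.

Lemma dunder_lower_sumLeaf t : dunder (lower_sum t) << Leaf >> = lower_sum t.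
Proof.
have -> : << Leaf >> = \sum_(i < 1) << Leaf >> :> Dend by rewrite big_ord1.
rewrite /dunder /lower_sum !projectiveE bilinear_extE; apply: eq_bigr => y _.
by rewrite big_ord1; congr << _ >>; elim: (ytree y) => //= l _ r ->.
Qed.

End LowerSums.

(** * Noncrossing trees *)

Section UniqueParent.

Variables (n : nat) (Q : edges n).
Hypothesis Qwf : wf_edges Q.
Hypothesis Qparent : forall i k j, (i, j) \in Q -> (k, j) \in Q -> i = k.

Local Notation child := (fun i j => (i, j) \in Q).

(** The largest vertex of a cycle has only smaller neighbours there, so both are its parent and
    coincide; the cycle has at most two vertices. *)
Lemma unique_parent_acyclic : acyclic Q.
Proof.
move=> c /andP[cyc_c uniq_c]; case: c => // x c in cyc_c uniq_c *.
have [m m_c max_m] := @arg_maxnP _ x (mem (x :: c)) (fun i : 'I_n.+1 => i : nat) (mem_head x c).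
have [k c' rot_c] := rot_to m_c.
rewrite -(size_rot k) rot_c; rewrite -(rot_cycle k) rot_c in cyc_c.
have lt_m i : i \in m :: c' -> adj Q m i || adj Q i m -> (i, m) \in Q.
  rewrite -rot_c mem_rot => /max_m /= le_im; rewrite /adj.
  have m_i : (m, i) \notin Q by apply/negP => /Qwf /=; lia.
  by rewrite (negbTE m_i) /= orbF orbb.
have uniq_mc : uniq (m :: c') by rewrite -rot_c rot_uniq.
case: c' => [|u [|v c']] // in lt_m cyc_c uniq_mc {rot_c} *.
move: cyc_c => /=; rewrite rcons_path -/(last u (v :: c')) => /andP[mu /andP[uv]].
move=> /andP[_ lm].
have last_c : last v c' \in v :: c' := mem_last v c'.
have um : (u, m) \in Q by apply: lt_m; rewrite ?mu // !inE eqxx orbT.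
have lastm : (last v c', m) \in Q.
  by apply: lt_m; rewrite ?lm ?orbT // 2!in_cons last_c !orbT.
move: uniq_mc; rewrite /= (Qparent um lastm) => /and3P[_ /negP[]].
exact: last_c.
Qed.

(** After stepping from [i] to a child [j], a simple path cannot descend again: the only smaller
    neighbour of [j] is [i], already visited. *)
Lemma child_path i p : path (adj Q) i p -> uniq (i :: p) ->
  (forall k, (k, i) \in Q -> k \notin p) -> path child i p.
Proof.
elim: p i => //= j p IHp i /andP[ij jp] /andP[i_jp uniq_jp] i_parent.
have {}ij : (i, j) \in Q.
  by case/orP: ij => // /i_parent; rewrite inE eqxx.
rewrite ij IHp // => k kj; rewrite (Qparent kj ij).
by apply: contra i_jp; rewrite inE orbC => ->.
Qed.

Lemma child_path_sorted i p : path child i p -> path ltn i (map val p).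
Proof. by elim: p i => //= j p IHp i /andP[/Qwf -> /IHp]. Qed.

Lemma child_path_uniq i p : path child i p -> uniq (i :: p).
Proof.
move=> /child_path_sorted ip; rewrite -(map_inj_uniq val_inj).
by apply: (sorted_uniq ltn_trans ltnn).
Qed.

(** Read backwards from the common end, each step is forced by uniqueness of parents. *)
Lemma child_path_inj i p q : path child i p -> path child i q ->
  last i p = last i q -> p = q.
Proof.
elim/last_ind: p q => [|p j IHp] q.
  move=> _ /child_path_uniq /=; case: q => //= j q /andP[i_jq _] last_q.
  by rewrite last_q mem_last in i_jq.
case/lastP: q => [/child_path_uniq /andP[+ _] _|q k].
  by rewrite last_rcons mem_rcons /= => + def_i; rewrite -def_i mem_head.
rewrite !rcons_path !last_rcons => /andP[ip pj] /andP[iq qk] def_j.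
by rewrite def_j (IHp q) //; apply: Qparent pj _; rewrite def_j.
Qed.

Lemma tree_path_child a b p : (forall k, (k, a) \notin Q) ->
  path child a p -> last a p = b -> tree_path Q a b = p.
Proof.
move=> a_root ap def_b; rewrite /tree_path; case: pickP => [q|/=].
  case/and3P=> aq uniq_q /eqP last_q; apply: (@child_path_inj a) => //.
    by apply: child_path => // k; rewrite (negbTE (a_root k)).
  by rewrite def_b.
(* [tree_path] searches only sequences of length at most [n]; [p] qualifies because [a :: p] repeats
   none of the [n.+1] vertices. *)
have size_p : size p <= n.
  rewrite -ltnS -[(size p).+1](card_uniqP (child_path_uniq ap)).
  by apply: leq_trans (max_card _) _; rewrite card_ord.
move=> /(_ (Bseq size_p)) /negP[]; rewrite /= def_b eqxx andbT.
have := child_path_uniq ap; rewrite /= => ->; rewrite andbT.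
by apply: sub_path ap => i j ij; rewrite /adj ij.
Qed.

End UniqueParent.

(** An edge of a larger forest [Q] closes a simple path of [P] into a cycle of [Q]. Acyclicity of
    [Q] shrinks that path to a single edge, so the edge was already in [P]. *)
Lemma connected_maximal n (P : edges n) : noncrossing_forest P ->
  (forall i j, connect (adj P) i j) -> noncrossing_tree P.
Proof.
move=> P_forest P_conn; split=> // Q [Qwf _ Qacyc] sPQ.
apply/eqP; rewrite eqEsubset sPQ andbT; apply/subsetP=> -[i j] ij.
have lt_ij := Qwf _ ij; case/connectP: (P_conn i j) => p0 /shortenP[p ip uniq_p _] def_j.
have : size (i :: p) <= 2.
  apply: Qacyc; rewrite /ucycle uniq_p andbT /= rcons_path -def_j.
  rewrite {2}/adj ij orbT andbT; apply: sub_path ip => k l.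
  by case/orP=> kl; rewrite /adj (subsetP sPQ _ kl) ?orbT.
case: p def_j ip {uniq_p} => [|k [|]] //= def_j; first by rewrite def_j ltnn in lt_ij.
rewrite andbT -def_j => /orP[] // /(subsetP sPQ)/Qwf /=.
by move: lt_ij => /=; lia.
Qed.

(** * The edge set of the noncrossing tree T(t) *)

(* On the vertices a, ..., a + degree t: an inner vertex of t which is the     *)
(* j-th in infix order and has d inner vertices in its left subtree gives the *)
(* edge (a + j - d.+1, a + j).                                                *)
Fixpoint tree_edge (t : tree) (a i j : nat) : bool :=
  if t is Node l r then
    [|| tree_edge l a i j, (i == a) && (j == a + (degree l).+1)
      | tree_edge r (a + (degree l).+1) i j]
  else false.

Lemma tree_edge_bounds t a i j :
  tree_edge t a i j -> [/\ a <= i, i < j & j <= a + degree t].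
Proof.
elim: t a => //= l IHl r IHr a /or3P[/IHl[]|/andP[/eqP -> /eqP ->]|/IHr[]]; split; lia.
Qed.

Lemma tree_edgeNF t a i j :
  (i < a) || (j <= i) || (a + degree t < j) -> tree_edge t a i j = false.
Proof. by move=> out; apply/negP => /tree_edge_bounds[]; lia. Qed.

(** The right ends of the edges from [l], of the joining edge, and of the edges from [r] lie in
    three disjoint ranges. *)
Lemma tree_edge_parent t a i k j :
  tree_edge t a i j -> tree_edge t a k j -> i = k.
Proof.
elim: t a => //= l IHl r IHr a.
move=> /or3P[ij|/andP[/eqP -> /eqP ->]|ij] /or3P[kj|/andP[/eqP ek /eqP ej]|kj];
  try by [apply: IHl kj | apply: IHr kj];
  try have [? ? ?] := tree_edge_bounds ij;
  try have [? ? ?] := tree_edge_bounds kj; lia.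
Qed.

Lemma tree_edge_noncrossing t a i j k l :
  tree_edge t a i j -> tree_edge t a k l -> ~~ [&& i < k, k < j & j < l].
Proof.
elim: t a => //= x IHx y IHy a.
move=> /or3P[ij|/andP[/eqP -> /eqP ->]|ij] /or3P[kl|/andP[/eqP -> /eqP ->]|kl];
  try by [apply: IHx kl | apply: IHy kl];
  try have [? ? ?] := tree_edge_bounds ij;
  try have [? ? ?] := tree_edge_bounds kl; lia.
Qed.

Section TreeEdges.

Variable n : nat.
Implicit Types (P Q : edges n) (t l r : tree).

Lemma tree_edge_connect Q t (a j : 'I_n.+1) :
  (forall i k : 'I_n.+1, tree_edge t a i k -> (i, k) \in Q) ->
  a + degree t <= n -> a <= j <= a + degree t -> connect (adj Q) a j.
Proof.
elim: t a => [|l IHl r IHr] a sub_Q /= le_n /andP[le_aj le_j].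
  by rewrite (_ : j = a) //; apply: val_inj => /=; lia.
have [le_jl|lt_lj] := leqP j (a + degree l).
  apply: IHl; [|lia|lia] => i k ik; apply: sub_Q; rewrite /= ik //.
have le_c : a + (degree l).+1 < n.+1 by lia.
apply: (@connect_trans _ _ (Ordinal le_c)).
  by apply: connect1; rewrite /adj sub_Q //= !eqxx orbT.
by apply: IHr => /= [i k ik||]; [apply: sub_Q; rewrite /= ik !orbT|lia|lia].
Qed.

(** * Paths, split vertices and the value of Phi on T(t) *)

Definition represents Q t (a : nat) :=
  forall i j : 'I_n.+1, ((i, j) \in Q) = tree_edge t a i j.

Lemma represents_wf Q t a : represents Q t a -> wf_edges Q.
Proof. by move=> QE [i j]; rewrite QE => /tree_edge_bounds[]. Qed.

Lemma represents_parent Q t a : represents Q t a ->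
  forall i k j, (i, j) \in Q -> (k, j) \in Q -> i = k.
Proof.
by move=> QE i k j; rewrite !QE => ij kj; apply/val_inj/(tree_edge_parent ij kj).
Qed.

(** The path from the first to the last vertex of T(t): one edge for each factor l/Y on the right
    spine of [t]. *)
Fixpoint spine t (a : nat) : seq 'I_n.+1 :=
  if t is Node l r then
    inord (a + (degree l).+1) :: spine r (a + (degree l).+1)
  else [::].

Lemma spine_path Q t (a : 'I_n.+1) :
  (forall i k : 'I_n.+1, tree_edge t a i k -> (i, k) \in Q) ->
  a + degree t <= n -> path (fun i j => (i, j) \in Q) a (spine t a).
Proof.
elim: t a => [|l _ r IHr] a sub_Q //= le_n.
have val_c : (inord (a + (degree l).+1) : 'I_n.+1) = a + (degree l).+1 :> nat.
  by rewrite inordK //; lia.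
rewrite sub_Q /= ?val_c ?eqxx ?orbT //= -{2}val_c.
apply: IHr => [i k|]; rewrite val_c; last lia.
by move=> ik; apply: sub_Q; rewrite /= ik !orbT.
Qed.

Lemma last_spine t (a : 'I_n.+1) : a + degree t <= n ->
  last a (spine t a) = a + degree t :> nat.
Proof.
elim: t a => [|l _ r IHr] a /= le_n; first by rewrite addn0.
have val_c : (inord (a + (degree l).+1) : 'I_n.+1) = a + (degree l).+1 :> nat.
  by rewrite inordK //; lia.
rewrite -{2}val_c IHr val_c; lia.
Qed.

Lemma tree_path_represents Q t (a b : 'I_n.+1) : b = a + degree t :> nat ->
  represents Q t a -> tree_path Q a b = spine t a.
Proof.
move=> def_b QE; have le_n : a + degree t <= n by have := ltn_ord b; lia.
apply: tree_path_child.
- exact: represents_wf QE.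
- exact: represents_parent QE.
- by move=> k; rewrite QE tree_edgeNF //; lia.
- by apply: spine_path => // i k; rewrite QE.
- by apply: val_inj; rewrite /= last_spine.
Qed.

(** Deleting the base side of T(l/Y) leaves T(l), whose edges connect exactly the vertices up to
    [a + degree l]; [b] is left isolated. *)
Lemma split_vertex_represents Q l (a b : 'I_n.+1) :
  b = a + (degree l).+1 :> nat -> represents Q (Node l Leaf) a ->
  split_vertex Q a b = a + degree l :> nat.
Proof.
move=> def_b QE; have lt_n := ltn_ord b.
have Q'E : represents (Q :\ (a, b)) l a.
  move=> i j; rewrite in_setD1 QE /= orbF xpair_eqE -!val_eqE /= def_b.
  case: (boolP ((i == a :> nat) && _)) => [/andP[/eqP -> /eqP ->]|_] /=.
    by rewrite tree_edgeNF //; lia.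
  by rewrite orbF.
have le_reach j : connect (adj (Q :\ (a, b))) a j -> j <= a + degree l.
  case/connectP=> p; elim/last_ind: p j => [|p k IHp] j; first by move=> _ ->; rewrite leq_addr.
  rewrite rcons_path last_rcons => /andP[ap]; rewrite /adj !Q'E => pk ->.
  by case/orP: pk => /tree_edge_bounds[]; lia.
have lt_d : a + degree l < n.+1 by lia.
rewrite /split_vertex; case: arg_maxnP => [|j aj max_j]; first exact: connect0.
apply/eqP; rewrite eqn_leq le_reach //=.
apply: (max_j (Ordinal lt_d)); apply: (@tree_edge_connect _ l) => /=; [|lia|lia].
by move=> i k; rewrite Q'E.
Qed.

(** Local form of [represents]: [Phi_rec] keeps the whole [P] while narrowing the interval, so only
    edges within that interval are controlled. *)
Definition agrees P t (a : nat) := forall i j : 'I_n.+1,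
  a <= i -> j <= a + degree t -> ((i, j) \in P) = tree_edge t a i j.

Lemma agrees_restrict P t (a b : 'I_n.+1) : b = a + degree t :> nat ->
  agrees P t a -> represents (restrict P a b) t a.
Proof.
move=> def_b PE i j; rewrite inE /= def_b.
case: (boolP ((a <= i) && _)) => [/andP[ai jb]|out]; first by rewrite andbT PE.
by rewrite andbF tree_edgeNF //; lia.
Qed.

Lemma agrees_left P l r a : agrees P (Node l r) a -> agrees P l a.
Proof.
move=> PE i j ai jl; rewrite PE /=; [|lia|lia].
by rewrite (@tree_edgeNF r) 1?(_ : (j == _) = false) ?andbF ?orbF //; lia.
Qed.

Lemma agrees_head P l r a : agrees P (Node l r) a -> agrees P (Node l Leaf) a.
Proof.
move=> PE i j ai /= jl; rewrite PE /=; [|lia|lia].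
by rewrite (@tree_edgeNF r) //; lia.
Qed.

Lemma agrees_right P l r a :
  agrees P (Node l r) a -> agrees P r (a + (degree l).+1).
Proof.
move=> PE i j ai jr; rewrite PE /=; [|lia|lia].
case: (boolP (tree_edge l a i j)) => [/tree_edge_bounds[]|_]; first lia.
by rewrite (_ : (i == a :> nat) = false) //; lia.
Qed.

Lemma agrees_Leaf P (a : 'I_n.+1) : wf_edges P -> agrees P Leaf a.
Proof. by move=> Pwf i j /=; rewrite addn0 => ai ja; apply/negP => /Pwf /=; lia. Qed.

(** Each path edge contributes the lower sum of a factor l/Y, and [lower_sum_under] multiplies the
    factors back to [s]. The bounds concern the two subtrees because [s] itself may have degree
    [k.+1]. *)
Lemma dstar_spine P k s (c : 'I_n.+1) :
  (forall l (a b : 'I_n.+1), b = a + (degree l).+1 :> nat -> degree l < k ->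
     agrees P (Node l Leaf) a -> Phi_rec k P a b = lower_sum (Node l Leaf)) ->
  (forall l r, s = Node l r -> degree l < k /\ degree r <= k) ->
  c + degree s <= n -> agrees P s c ->
  \big[dstar / << Leaf >>%R]_(e <- zip (c :: spine s c) (spine s c)) Phi_rec k P e.1 e.2
    = lower_sum s.
Proof.
move=> Phi_seg; elim: s c => [|l _ r IHr] c small /= le_n PE.
  by rewrite big_nil lower_sum_Leaf.
have val_d : (inord (c + (degree l).+1) : 'I_n.+1) = c + (degree l).+1 :> nat.
  by rewrite inordK //; lia.
have [lt_l le_r] := small l r (erefl _).
rewrite big_cons /= (Phi_seg l) //; last exact: agrees_head PE.
rewrite -[in spine r _]val_d IHr ?val_d -?lower_sum_under //; last exact: agrees_right PE.
- by move=> l' r' def_r; move: le_r; rewrite def_r /=; lia.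
- by lia.
Qed.

Lemma Phi_rec_lower_sum k P t (a b : 'I_n.+1) : wf_edges P ->
  b = a + degree t :> nat -> degree t <= k -> agrees P t a ->
  Phi_rec k P a b = lower_sum t.
Proof.
move=> Pwf; elim: k t a b => [|k IHk] [|l r] a b //= def_b le_k PE.
- by rewrite lower_sum_Leaf.
- by rewrite lower_sum_Leaf ifT // -val_eqE /= def_b addn0.
have lt_b := ltn_ord b.
rewrite ifF; last by rewrite -val_eqE /= def_b; lia.
(* The edge of the root ends at [a + degree l + 1], which is [b] exactly when [r] is a dot. *)
have -> : ((a, b) \in P) = (r == Leaf).
  rewrite PE /= ?def_b ?eqxx //= (@tree_edgeNF l) ?(@tree_edgeNF r) ?orbF; [|lia|lia].
  case: r {PE def_b le_k} => [|r1 r2] /=; first by rewrite addn0 eqxx.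
  by apply/negP => /eqP; lia.
have QE := agrees_restrict (t := Node l r) def_b PE.
case: eqP => [def_r|r_nontriv].
  rewrite def_r addn0 in def_b le_k QE *.
  have j_l := split_vertex_represents def_b QE; move: j_l.
  set j := split_vertex _ _ _ => j_l.
  (* The part to the right of the split is the single vertex [b], sent to the neutral dot. *)
  have -> : inord j.+1 = b.
    by apply: val_inj; rewrite /= inordK; lia.
  rewrite (IHk l) //; last exact: agrees_left PE.
  rewrite (IHk Leaf) ?addn0 //; last exact: agrees_Leaf.
  by rewrite lower_sum_Leaf -lower_sum_NodeLeaf dunder_lower_sumLeaf.
rewrite (tree_path_represents (t := Node l r)) //.
apply: dstar_spine => //=; last lia.
  move=> l' a' b' def_b' lt_l' PE'; apply: IHk => //=; lia.
(* As [r] is not a dot, the first factor l/Y is strictly smaller than [t], so [k] bounds its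
   degree. *)
move=> _ _ [<- <-]; have : 0 < degree r by case: r r_nontriv {PE def_b le_k QE}.
by lia.
Qed.

End TreeEdges.

Theorem theorem4p6 (n : nat) (hn : (1 <= n)%N) (x : Y n) :
  exists P : edges n,
    [/\ noncrossing_tree P,
        (ord0, inord 1) \in P
      & Phi P = projective x].
Proof.
pose P : edges n := [set e : 'I_n.+1 * 'I_n.+1 | tree_edge x 0 e.1 e.2]; exists P.
have PE : represents P x 0 by move=> i j; rewrite inE.
have Pwf := represents_wf PE.
have deg_x := degreeY x.
split; last first.
- by rewrite lower_sumE; apply: Phi_rec_lower_sum; rewrite ?deg_x //.
- rewrite PE inordK //.
  have : 0 < degree x by rewrite deg_x.
  (* Descend the left spine: its last vertex comes first in infix order and has an empty left
     subtree, so it gives the edge from 0 to 1. *)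
  elim: (ytree x) => // -[|l1 l2] IHl r _ _ //=.
  by move: IHl => /= ->.
apply: connected_maximal.
  split=> //; last exact: unique_parent_acyclic Pwf (represents_parent PE).
  by move=> e f; rewrite !inE; apply: tree_edge_noncrossing.
have from0 j : connect (adj P) ord0 j.
  apply: (@tree_edge_connect _ _ x); rewrite ?deg_x //=; last by rewrite -ltnS ltn_ord.
  by move=> i k; rewrite PE.
have adj_sym : connect_sym (adj P).
  by apply: sym_connect_sym => i j; rewrite /adj orbC.
by move=> i j; apply: connect_trans (from0 j); rewrite adj_sym.
Qed.
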